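(* Let $\mathbb{F}$ be a field with involution $\overline{\,\cdot\,}$, let $m,n\ge 1$, let $x,y\in\mathbb{F}^m$ and $z,w\in\mathbb{F}^n$ be column vectors with all entries nonzero, let $a,b\in\mathbb{F}\setminus\{0\}$, and let $$M=\left[\begin{array}{cc|cc}0&x^T&a&0\\ y&0&0&0\\ \hline b&0&0&z^T\\ 0&0&w&0\end{array}\right]$$ (a square matrix of order $m+n+2$). Assume $x^Ty\neq 0$, $z^Tw=0$ and $\zeta:=x^Ty+ab\neq 0$, and that $M$ is Moore–Penrose invertible and its core EP inverse $M^{\mathrm{cEP}}$ exists (equivalently, the scalars $s=x^*x$, $u=y^*y$, $t=z^*z$, $v=w^*w$, $h=b\overline{b}+y^*y$, $\beta=\zeta\overline{\zeta}+b\overline{b}\,w^*w$ are all nonzero). Then the GDC inverse of $M$ is $$M^{\mathrm{GDC}}=\left[\begin{array}{cc|cc}0&\beta^{-1}\overline{\zeta}x^T&\beta^{-1}(a\overline{\zeta}+\overline{b}w^*w)&0\\ (s\zeta)^{-1}(x^Ty)\overline{x}&0&0&\overline{b}(hs\zeta)^{-1}(x^Ty)\overline{x}z^T\\ \hline b\zeta^{-1}&0&0&b\overline{b}(h\zeta)^{-1}z^T\\ 0&0&0&0\end{array}\right].$$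
   Context: For a matrix $A=[a_{ij}]$ over a field $\mathbb{F}$ with involution $\overline{\,\cdot\,}$ (a field automorphism with $\overline{\overline{c}}=c$), $\overline{A}=[\overline{a_{ij}}]$ and $A^*=\overline{A}^{\,T}$. All $4\times4$ block matrices have rows and columns partitioned with sizes $1,m,1,n$; each $0$ is a zero block of the appropriate size. Matrices $M$ of the displayed form are the matrices whose associated digraph is a double star digraph, in canonical form. The Moore–Penrose inverse $A^\dagger$ is the unique $X$ (if it exists) with $AXA=A$, $XAX=X$, $(AX)^*=AX$, $(XA)^*=XA$. A square matrix $A$ is core EP invertible if there is $X$ with $XA^{k+1}=A^k$ for some nonnegative integer $k$, $AX^2=X$, $(AX)^*=AX$; such $X$ is unique, called the core EP inverse and denoted $A^{\mathrm{cEP}}$. When $A^\dagger$ and $A^{\mathrm{cEP}}$ exist, the generalized dual core (GDC) inverse $A^{\mathrm{GDC}}$ is the unique $X$ with $XAX=X$, $AX=A^{\mathrm{cEP}}A$, $XA=A^\dagger A^{\mathrm{cEP}}A^2$; explicitly $A^{\mathrm{GDC}}=A^\dagger A^{\mathrm{cEP}}A$. *)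

(* Defs.v *)
From mathcomp Require Import all_boot all_order all_algebra.

Set Implicit Arguments.
Unset Strict Implicit.
Unset Printing Implicit Defensive.

Import GRing.Theory.
Local Open Scope ring_scope.

Definition adjmx (F : fieldType) (conj : {rmorphism F -> F}) (p q : nat)
    (A : 'M[F]_(p, q)) : 'M[F]_(q, p) :=
  (map_mx conj A)^T.

Definition is_mp_inverse (F : fieldType) (conj : {rmorphism F -> F})
    (p q : nat) (A : 'M[F]_(p, q)) (X : 'M[F]_(q, p)) : Prop :=
  [/\ A *m X *m A = A,
      X *m A *m X = X,
      adjmx conj (A *m X) = A *m X
    & adjmx conj (X *m A) = X *m A].

(* The exponent k is part of the existential: it need not be the index of A. *)
Definition is_core_ep_inverse (F : fieldType) (conj : {rmorphism F -> F})
    (p : nat) (A X : 'M[F]_p) : Prop :=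
  [/\ exists k : nat, X *m A ^+ k.+1 = A ^+ k,
      A *m X ^+ 2 = X
    & adjmx conj (A *m X) = A *m X].

Definition mp_invertible (F : fieldType) (conj : {rmorphism F -> F})
    (p q : nat) (A : 'M[F]_(p, q)) : Prop :=
  exists X, is_mp_inverse conj A X.

Definition core_ep_invertible (F : fieldType) (conj : {rmorphism F -> F})
    (p : nat) (A : 'M[F]_p) : Prop :=
  exists X, is_core_ep_inverse conj A X.

(* Ad and Ac are the (unique) Moore-Penrose and core EP inverses of A; the
   predicate is false when one of them does not exist. *)
Definition is_gdc_inverse (F : fieldType) (conj : {rmorphism F -> F})
    (p : nat) (A X : 'M[F]_p) : Prop :=
  exists Ad Ac : 'M[F]_p,
    [/\ is_mp_inverse conj A Ad, is_core_ep_inverse conj A Ac &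
    [/\ X *m A *m X = X,
        A *m X = Ac *m A
      & X *m A = Ad *m Ac *m A ^+ 2]].

(* vdot x y is the scalar x^T y. *)
Definition vdot (F : fieldType) (p : nat) (x y : 'cV[F]_p) : F :=
  (x^T *m y) 0 0.

(* hvdot conj x y is the scalar x^* y. *)
Definition hvdot (F : fieldType) (conj : {rmorphism F -> F}) (p : nat)
    (x y : 'cV[F]_p) : F :=
  (adjmx conj x *m y) 0 0.

Definition double_star_mx (F : fieldType) (m n : nat)
    (x y : 'cV[F]_m) (z w : 'cV[F]_n) (a b : F) :
    'M[F]_((1 + m) + (1 + n)) :=
  block_mx
    (block_mx 0 x^T
              y 0)     (block_mx a%:M 0
                                 0    0)
    (block_mx b%:M 0
              0    0)  (block_mx 0 z^T
                                 w 0).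

(* Main.v *)
Require Import Defs.
From mathcomp Require Import all_boot all_order all_algebra.
From mathcomp Require Import ring.

Set Implicit Arguments.
Unset Strict Implicit.
Unset Printing Implicit Defensive.

Import GRing.Theory.
Local Open Scope ring_scope.

(** The matrix [M] acts on blocks [(p, q, r, s)] by
      [M (p, q, r, s) = (x^T q + a r, p y, b p + z^T s, r w)].

    Moore-Penrose part. Collapsing the leaves of each star to one vertex writes
    [M = diag(1, y, 1, w) K diag(1, x^T, 1, z^T)] with [K] the invertible
    weighted adjacency matrix of a path on four vertices. When [y^* y], [w^* w],
    [x^* x] and [z^* z] are nonzero, the outer factors have evident one-sided
    inverses whose products with them are self-adjoint, which gives the
    Moore-Penrose inverse [D] of [M]. Conversely, if [y^* y] or [w^* w]
    vanishes, then [(0, y, 0, 0)] or [(0, 0, 0, w)] is a nonzero vector of the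
    range that is orthogonal to the range, which a Moore-Penrose inverse forbids
    ([mp_range_anisotropic]); [x] and [z] follow by passing to [M^*], which is
    again a double star matrix.

    Core EP part. Put [g1 = (zeta, 0, 0, b w)] and [g2 = (0, y, b, 0)]. Then
    [M g2 = g1], and [z^T w = 0] gives [M g1 = zeta g2] and makes the range of
    [M^3] equal to the plane spanned by [g1] and [g2]. These two vectors are
    orthogonal, with [g1^* g1 = beta] and [g2^* g2 = h]. If these scalars are
    nonzero, the core EP inverse is [beta^-1 g2 g1^* + (zeta h)^-1 g1 g2^*]
    ([core_ep_two_cycle]); if one of them vanishes, the corresponding vector
    lies in the range of every [M^k] and is orthogonal to the range of [M^3],
    which a core EP inverse forbids ([core_ep_eigen_anisotropic]).

    The generalized dual core inverse is the product of [D], the core EP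
    inverse and [M] ([gdc_inverse_unique]). It is therefore
    [beta^-1 (D g2) (M^* g1)^* + (zeta h)^-1 (D g1) (M^* g2)^*], where
    [D g2 = (1, 0, 0, 0)] and
    [D g1 = (0, (x^* x)^-1 (x^T y) (conj x), b, 0)]; expanding the two outer
    products gives the displayed matrix. *)

Section DoubleStar.

Variables (F : fieldType) (conj : {rmorphism F -> F}).
Hypothesis conjK : involutive conj.

Local Notation adj := (adjmx conj).

(** * Conjugate transposes *)

Lemma adjmxM p q r (A : 'M[F]_(p, q)) (B : 'M[F]_(q, r)) :
  adj (A *m B) = adj B *m adj A.
Proof. by rewrite /adjmx map_mxM trmx_mul. Qed.

Lemma adjmxK p q (A : 'M[F]_(p, q)) : adj (adj A) = A.
Proof. by apply/matrixP=> i j; rewrite !mxE conjK. Qed.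

Lemma adjmxD p q (A B : 'M[F]_(p, q)) : adj (A + B) = adj A + adj B.
Proof. by rewrite /adjmx map_mxD linearD. Qed.

Lemma adjmxZ p q c (A : 'M[F]_(p, q)) : adj (c *: A) = conj c *: adj A.
Proof. by rewrite /adjmx map_mxZ linearZ. Qed.

Lemma adjmx0 p q : adj (0 : 'M[F]_(p, q)) = 0.
Proof. by rewrite /adjmx map_mx0 trmx0. Qed.

Lemma adjmx_scalar p c : adj (c%:M : 'M[F]_p) = (conj c)%:M.
Proof. by rewrite /adjmx map_scalar_mx tr_scalar_mx. Qed.

Lemma adjmx_block p1 p2 q1 q2 (A : 'M[F]_(p1, q1)) (B : 'M[F]_(p1, q2))
    (C : 'M[F]_(p2, q1)) (D : 'M[F]_(p2, q2)) :
  adj (block_mx A B C D) = block_mx (adj A) (adj C) (adj B) (adj D).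
Proof. by rewrite /adjmx map_block_mx tr_block_mx. Qed.

Lemma adjmx_col p1 p2 q (A : 'M[F]_(p1, q)) (B : 'M[F]_(p2, q)) :
  adj (col_mx A B) = row_mx (adj A) (adj B).
Proof. by rewrite /adjmx map_col_mx tr_col_mx. Qed.

Lemma adjmxX p (A : 'M[F]_p) k : adj (A ^+ k) = adj A ^+ k.
Proof.
elim: k => [|k IHk]; first by rewrite !expr0 adjmx_scalar rmorph1.
by rewrite exprS exprSr -mulmxE adjmxM IHk.
Qed.

(** * The Moore-Penrose inverse *)

Lemma mp_inverse_adj p q (A : 'M[F]_(p, q)) X :
  is_mp_inverse conj A X -> is_mp_inverse conj (adj A) (adj X).
Proof.
case=> AXA XAX hAX hXA; split.
- by rewrite -!adjmxM mulmxA AXA.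
- by rewrite -!adjmxM mulmxA XAX.
- by rewrite -adjmxM hXA.
- by rewrite -adjmxM hAX.
Qed.

(** [A X] and [A Y] are self-adjoint and each absorbs the other on one side,
    because [A X A = A = A Y A]; taking adjoints makes them equal. The same
    holds for [X A] and [Y A], so that [X = X A X = Y A X = Y A Y = Y]. *)
Lemma mp_inverse_unique p q (A : 'M[F]_(p, q)) X Y :
  is_mp_inverse conj A X -> is_mp_inverse conj A Y -> X = Y.
Proof.
move=> [AXA XAX hAX hXA] [AYA YAY hAY hYA].
have eAX : A *m X = A *m Y.
  by rewrite -[in LHS]AYA -[LHS]mulmxA -hAY -hAX -adjmxM mulmxA AXA.
have eXA : X *m A = Y *m A.
  rewrite -[in LHS]AYA 2!mulmxA -mulmxA -hXA -hYA -adjmxM.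
  by rewrite -mulmxA (mulmxA A) AXA.
by rewrite -XAX eXA -mulmxA eAX mulmxA YAY.
Qed.

(** For an involution a nonzero vector can be orthogonal to itself. The
    obstruction to Moore-Penrose invertibility is a nonzero vector of the range
    that is orthogonal to the whole range: the self-adjoint idempotent [A X]
    fixes the range, and it kills every vector orthogonal to the range. *)
Lemma mp_range_anisotropic p q r (A : 'M[F]_(p, q)) X (d : 'M[F]_(q, r)) :
  is_mp_inverse conj A X -> adj A *m (A *m d) = 0 -> A *m d = 0.
Proof.
move=> [AXA _ hAX _] Ad0.
by rewrite -AXA -mulmxA -hAX adjmxM -mulmxA Ad0 mulmx0.
Qed.

(** The inner factors cancel in both products, which leaves [U U'] and [V' V].
    Thus the Moore-Penrose inverse of a full rank factorization is built from
    those of its two outer factors. *)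
Lemma mp_inverse_factor p q r (U : 'M[F]_(p, r)) (K : 'M[F]_r)
    (V : 'M[F]_(r, q)) (U' : 'M[F]_(r, p)) (K' : 'M[F]_r)
    (V' : 'M[F]_(q, r)) :
  U' *m U = 1%:M -> adj (U *m U') = U *m U' ->
  V *m V' = 1%:M -> adj (V' *m V) = V' *m V ->
  K *m K' = 1%:M ->
  is_mp_inverse conj (U *m K *m V) (V' *m K' *m U').
Proof.
move=> U'U hU VV' hV KK'; have K'K := mulmx1C KK'.
have AX : U *m K *m V *m (V' *m K' *m U') = U *m U'.
  by rewrite !mulmxA -(mulmxA (U *m K)) VV' mulmx1 -(mulmxA U) KK' mulmx1.
have XA : V' *m K' *m U' *m (U *m K *m V) = V' *m V.
  by rewrite !mulmxA -(mulmxA (V' *m K')) U'U mulmx1 -(mulmxA V') K'K mulmx1.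
split; rewrite ?AX ?XA //.
- by rewrite !mulmxA -(mulmxA U) U'U mulmx1.
- by rewrite !mulmxA -(mulmxA V') VV' mulmx1.
Qed.

(** * The core EP inverse *)

Lemma core_ep_powK p (A X : 'M[F]_p) k :
  A *m X ^+ 2 = X -> A ^+ k *m X ^+ k.+1 = X.
Proof.
rewrite mulmxE => AX2; elim: k => [|k IHk]; first by rewrite mul1r.
by rewrite exprS (exprSr X) mulrA -(mulrA A) IHk -mulrA -expr2 AX2.
Qed.

Lemma core_ep_index p (A X : 'M[F]_p) :
  is_core_ep_inverse conj A X ->
  exists K, forall k, (K <= k)%N -> X *m A ^+ k.+1 = A ^+ k.
Proof.
case=> [[K XAK] _ _]; exists K => k /subnKC <-.
by rewrite -addSn !exprD -mulmxE mulmxA XAK.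
Qed.

(** The range of [A X] lies in the range of every power of [A]. With
    [core_ep_projK], this says that the self-adjoint [A X] is the orthogonal
    projector onto the eventual range of [A]. *)
Lemma core_ep_proj p (A X : 'M[F]_p) k :
  A *m X ^+ 2 = X -> A *m X = A ^+ k.+1 *m X ^+ k.+1.
Proof. by move=> AX2; rewrite exprS -mulmxE -mulmxA core_ep_powK. Qed.

Lemma core_ep_projK p (A X : 'M[F]_p) k :
  X *m A ^+ k.+1 = A ^+ k -> A *m X *m A ^+ k.+1 = A ^+ k.+1.
Proof. by move=> XAk; rewrite -mulmxA XAk mulmxE -exprS. Qed.

Lemma core_ep_outer p (A X : 'M[F]_p) :
  is_core_ep_inverse conj A X -> X *m A *m X = X.
Proof.
move=> cX; have [K XK] := core_ep_index cX; have [_ AX2 _] := cX.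
by rewrite -mulmxA (core_ep_proj K AX2) mulmxA XK // core_ep_powK.
Qed.

(** The projectors [A X] and [A Y] have the same range, and are self-adjoint, so
    they are equal. Then [X = X (A Y)], and since the columns of [A Y] lie in
    the range of a high power of [A], on which [X] inverts [A], this is [Y]. *)
Lemma core_ep_unique p (A X Y : 'M[F]_p) :
  is_core_ep_inverse conj A X -> is_core_ep_inverse conj A Y -> X = Y.
Proof.
have proj B C : is_core_ep_inverse conj A B -> is_core_ep_inverse conj A C ->
    A *m B *m (A *m C) = A *m C.
  move=> cB [_ AC2 _]; have [K BK] := core_ep_index cB.
  by rewrite (core_ep_proj K AC2) mulmxA core_ep_projK // BK.
move=> cX cY; have [_ AX2 hX] := cX; have [_ AY2 hY] := cY.
have AXAY : A *m X = A *m Y.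
  by rewrite -(proj _ _ cX cY) -hX -hY -adjmxM (proj _ _ cY cX).
have [K XK] := core_ep_index cX.
rewrite -(core_ep_outer cX) -mulmxA AXAY (core_ep_proj K AY2) mulmxA XK //.
exact: core_ep_powK.
Qed.

(** An eigenvector [c] of a power of [A] for a nonzero eigenvalue lies in the
    range of every power of [A], hence is fixed by the projector [A X]. The
    hypothesis on [adj A] says that [c] is orthogonal to the range of
    [A ^+ k.+1], hence that [A X] kills it. *)
Lemma core_ep_eigen_anisotropic p (A X : 'M[F]_p) (c : 'cV[F]_p) (mu : F) j k :
  is_core_ep_inverse conj A X -> mu != 0 -> A ^+ j.+1 *m c = mu *: c ->
  adj A ^+ k.+1 *m c = 0 -> c = 0.
Proof.
move=> cX mu0 Ac Ac0; have [K XK] := core_ep_index cX.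
have [_ AX2 hX] := cX.
have cE i : A ^+ (j.+1 * i) *m c = mu ^+ i *: c.
  elim: i => [|i IHi]; first by rewrite muln0 !expr0 scale1r mul1mx.
  by rewrite mulnS exprD -mulmxE -mulmxA IHi -scalemxAr Ac scalerA -exprSr.
have Pc : A *m X *m c = c.
  apply: (scalerI (expf_neq0 K.+1 mu0)).
  rewrite scalemxAr -cE; have -> : (j.+1 * K.+1 = (K + j * K.+1).+1)%N by [].
  by rewrite mulmxA core_ep_projK // XK // leq_addr.
rewrite -Pc -hX (core_ep_proj k AX2) adjmxM !adjmxX -mulmxA.
by rewrite Ac0 mulmx0.
Qed.

(** The eventual range of [A] is here the plane of two orthogonal vectors that
    are not self-orthogonal, and [A] swaps them up to the scalar [mu]. The core
    EP inverse is the orthogonal projection onto this plane followed by the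
    inverse of [A] there, which is [g1 |-> g2], [g2 |-> mu^-1 g1]. *)
Lemma core_ep_two_cycle p (A : 'M[F]_p) (g1 g2 e1 e2 : 'cV[F]_p)
    (mu c1 c2 : F) k :
  mu != 0 -> c1 != 0 -> c2 != 0 ->
  adj g1 *m g1 = c1%:M -> adj g2 *m g2 = c2%:M -> adj g1 *m g2 = 0 ->
  A *m g2 = g1 -> A *m g1 = mu *: g2 ->
  A ^+ k = g1 *m adj e1 + g2 *m adj e2 ->
  is_core_ep_inverse conj A
    (c1^-1 *: (g2 *m adj g1) + (mu * c2)^-1 *: (g1 *m adj g2)).
Proof.
move=> mu0 c10 c20 g11 g22 g12 Ag2 Ag1 Ak.
set X := (X in is_core_ep_inverse _ _ X).
have g21 : adj g2 *m g1 = 0 by rewrite -[g1]adjmxK -adjmxM g12 adjmx0.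
have hc g c : adj g *m g = c%:M :> 'M_1 -> conj c = c.
  move=> gg; have := congr1 (fun B => adj B) gg.
  rewrite adjmxM adjmxK gg adjmx_scalar.
  by move=> /matrixP /(_ 0 0); rewrite !mxE.
have Xg1 : X *m g1 = g2.
  rewrite mulmxDl -!scalemxAl -!mulmxA g11 g21 mulmx0 scaler0 addr0.
  by rewrite mul_mx_scalar scalerA mulVf // scale1r.
have Xg2 : X *m g2 = mu^-1 *: g1.
  rewrite mulmxDl -!scalemxAl -!mulmxA g12 g22 mulmx0 scaler0 add0r.
  by rewrite mul_mx_scalar scalerA invfM mulfVK.
have AX : A *m X = c1^-1 *: (g1 *m adj g1) + c2^-1 *: (g2 *m adj g2).
  rewrite mulmxDr -!scalemxAr !mulmxA Ag1 Ag2 -scalemxAl scalerA.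
  by rewrite invfM mulrAC mulVf // mul1r.
split.
- exists k; rewrite exprS -mulmxE Ak (mulmxDr A) !(mulmxA A) Ag1 Ag2.
  rewrite mulmxDr !mulmxA -scalemxAr Xg1 Xg2 scalerA mulfV // scale1r.
  by rewrite addrC.
- have AXg1 : A *m X *m g1 = g1 by rewrite -mulmxA Xg1.
  have AXg2 : A *m X *m g2 = g2.
    by rewrite -mulmxA Xg2 -scalemxAr Ag1 scalerA mulVf // scale1r.
  rewrite expr2 -mulmxE mulmxA [in X in _ *m X]/X mulmxDr -!scalemxAr.
  by rewrite (mulmxA _ g1) (mulmxA _ g2) AXg1 AXg2.
- rewrite AX adjmxD !adjmxZ !adjmxM !adjmxK !fmorphV.
  by rewrite (hc _ _ _ g11) (hc _ _ _ g22).
Qed.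

(** * The generalized dual core inverse *)

(** The products [A X] and [X A] are prescribed, hence so is [X = X A X]. The
    explicit matrix satisfies the three equations because [Ac], whose columns
    lie in the range of [A], is fixed by [A Ad]. *)
Lemma gdc_inverse_unique p (A Ad Ac : 'M[F]_p) :
  is_mp_inverse conj A Ad -> is_core_ep_inverse conj A Ac ->
  unique (is_gdc_inverse conj A) (Ad *m Ac *m A).
Proof.
move=> mA cA; have cAc := core_ep_outer cA.
have [AAdA _ _ _] := mA; have [_ AAc2 _] := cA.
have AAdAc : A *m Ad *m Ac = Ac.
  by rewrite -[in LHS]AAc2 mulmxA AAdA AAc2.
split.
- have AG : A *m (Ad *m Ac *m A) = Ac *m A by rewrite !mulmxA AAdAc.
  exists Ad, Ac; split=> //; split=> //.
  + by rewrite -mulmxA AG -!mulmxA (mulmxA Ac A) (mulmxA (Ac *m A)) cAc.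
  + by rewrite expr2 -mulmxE !mulmxA.
- move=> X [Bd [Bc [mB cB [XAX AX XA]]]].
  rewrite (mp_inverse_unique mA mB) (core_ep_unique cA cB).
  rewrite -[RHS]XAX XA expr2 -mulmxE -!mulmxA AX (mulmxA Bc A).
  by rewrite (mulmxA (Bc *m A)) (core_ep_outer cB).
Qed.

(** * Bilinear and sesquilinear dot products *)

Lemma vdotE p (x y : 'cV[F]_p) : x^T *m y = (vdot x y)%:M.
Proof. exact: mx11_scalar. Qed.

Lemma vdotC p (x y : 'cV[F]_p) : vdot x y = vdot y x.
Proof. by rewrite /vdot -[x^T *m y]trmxK trmx_mul trmxK mxE. Qed.

Lemma vdotZr p c (x y : 'cV[F]_p) : vdot x (c *: y) = c * vdot x y.
Proof. by rewrite /vdot -scalemxAr mxE. Qed.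

Lemma vdot0r p (x : 'cV[F]_p) : vdot x 0 = 0.
Proof. by rewrite /vdot mulmx0 mxE. Qed.

Lemma vdotZl p c (x y : 'cV[F]_p) : vdot (c *: x) y = c * vdot x y.
Proof. by rewrite vdotC vdotZr vdotC. Qed.

Lemma vdot0l p (x : 'cV[F]_p) : vdot 0 x = 0.
Proof. by rewrite vdotC vdot0r. Qed.

Lemma vdot_conj p (x y : 'cV[F]_p) :
  vdot (map_mx conj x) (map_mx conj y) = conj (vdot x y).
Proof. by rewrite /vdot map_trmx -map_mxM mxE. Qed.

Lemma map_conjK p (x : 'cV[F]_p) : map_mx conj (map_mx conj x) = x.
Proof. by apply/matrixP=> i j; rewrite !mxE conjK. Qed.

Lemma hvdotE p (x y : 'cV[F]_p) : hvdot conj x y = vdot (map_mx conj x) y.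
Proof. by []. Qed.

Lemma hvdot_conj p (x : 'cV[F]_p) : conj (hvdot conj x x) = hvdot conj x x.
Proof. by rewrite !hvdotE -vdot_conj map_conjK; apply: vdotC. Qed.

Lemma adj_tr p (x : 'cV[F]_p) : adj x^T = map_mx conj x.
Proof. by rewrite /adjmx -map_trmx trmxK. Qed.

(** Used to cancel an entry [a] or [b] of a double star matrix by a combination
    of the columns of the leaves in the same row. *)
Lemma vdot_eq1_ex p (x : 'cV[F]_p) :
  (0 < p)%N -> (forall i, x i 0 != 0) -> exists d, vdot x d = 1.
Proof.
case: p x => // p x _ x0; exists ((x 0 0)^-1 *: delta_mx 0 0).
rewrite vdotZr /vdot mxE (bigD1 0) //= big1 ?addr0 => [|i i0].
  by rewrite !mxE !eqxx mulr1 mulVf.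
by rewrite !mxE (negPf i0) mulr0.
Qed.

(** * Vectors and block diagonal matrices for the partition (1, m, 1, n) *)

(** The two unit entries sit at the centres of the stars. *)
Definition star_diag m1 m2 n1 n2 (P : 'M[F]_(m1, n1)) (Q : 'M[F]_(m2, n2)) :
    'M[F]_((1 + m1) + (1 + m2), (1 + n1) + (1 + n2)) :=
  block_mx (block_mx 1%:M 0 0 P) 0 0 (block_mx 1%:M 0 0 Q).

Definition star_col m n (p : F) (q : 'cV[F]_m) (r : F) (s : 'cV[F]_n) :
    'cV[F]_((1 + m) + (1 + n)) :=
  col_mx (col_mx p%:M q) (col_mx r%:M s).

Lemma star_diagM m1 m2 n1 n2 r1 r2 (P : 'M[F]_(m1, n1)) (Q : 'M[F]_(m2, n2))
    (P' : 'M[F]_(n1, r1)) (Q' : 'M[F]_(n2, r2)) :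
  star_diag P Q *m star_diag P' Q' = star_diag (P *m P') (Q *m Q').
Proof.
by rewrite /star_diag !mulmx_block !(mul0mx, mulmx0, addr0, add0r, mul1mx).
Qed.

Lemma star_diag1 m n : star_diag (1%:M : 'M_m) (1%:M : 'M_n) = 1%:M.
Proof. by rewrite /star_diag -!scalar_mx_block. Qed.

Lemma adj_star_diag m1 m2 n1 n2 (P : 'M[F]_(m1, n1)) (Q : 'M[F]_(m2, n2)) :
  adj (star_diag P Q) = star_diag (adj P) (adj Q).
Proof. by rewrite /star_diag !adjmx_block !adjmx0 !adjmx_scalar rmorph1. Qed.

Lemma star_diag_col m1 m2 n1 n2 (P : 'M[F]_(m1, n1)) (Q : 'M[F]_(m2, n2))
    p q r s :
  star_diag P Q *m star_col p q r s = star_col p (P *m q) r (Q *m s).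
Proof.
rewrite /star_diag /star_col !mul_block_col.
by rewrite !(mul0mx, addr0, add0r, mul1mx).
Qed.

Lemma star_colP m n (c : 'cV[F]_((1 + m) + (1 + n))) :
  exists p q r s, c = star_col p q r s.
Proof.
exists (usubmx (usubmx c) 0 0), (dsubmx (usubmx c)).
exists (usubmx (dsubmx c) 0 0), (dsubmx (dsubmx c)).
by rewrite /star_col -!mx11_scalar !vsubmxK.
Qed.

Lemma star_col_inj m n p p' (q q' : 'cV[F]_m) r r' (s s' : 'cV[F]_n) :
  star_col p q r s = star_col p' q' r' s' ->
  [/\ p = p', q = q', r = r' & s = s'].
Proof.
case/eq_col_mx=> /eq_col_mx[pp ->] /eq_col_mx[rr ->].
split=> //; [move/matrixP/(_ 0 0): pp | move/matrixP/(_ 0 0): rr];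
  by rewrite !mxE !mulr1n.
Qed.

Lemma star_col0 m n : star_col 0 (0 : 'cV_m) 0 (0 : 'cV_n) = 0.
Proof. by rewrite /star_col raddf0 !col_mx0. Qed.

Lemma star_colZ m n c p (q : 'cV[F]_m) r (s : 'cV[F]_n) :
  c *: star_col p q r s = star_col (c * p) (c *: q) (c * r) (c *: s).
Proof. by rewrite /star_col !scale_col_mx !scale_scalar_mx. Qed.

Lemma star_colD m n p p' (q q' : 'cV[F]_m) r r' (s s' : 'cV[F]_n) :
  star_col p q r s + star_col p' q' r' s' =
  star_col (p + p') (q + q') (r + r') (s + s').
Proof. by rewrite /star_col !add_col_mx !raddfD. Qed.

Lemma star_col_adjM m n p p' (q q' : 'cV[F]_m) r r' (s s' : 'cV[F]_n) :
  adj (star_col p q r s) *m star_col p' q' r' s' =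
  (conj p * p' + hvdot conj q q' + (conj r * r' + hvdot conj s s'))%:M.
Proof.
rewrite /star_col !adjmx_col !mul_row_col !adjmx_scalar -!scalar_mxM.
by rewrite [adj q *m _]vdotE [adj s *m _]vdotE !raddfD.
Qed.

(** * The action of a double star matrix *)

Lemma double_star_col m n (x y q : 'cV[F]_m) (z w s : 'cV[F]_n) a b p r :
  double_star_mx x y z w a b *m star_col p q r s =
  star_col (vdot x q + a * r) (p *: y) (b * p + vdot z s) (r *: w).
Proof.
rewrite /double_star_mx /star_col !mul_block_col.
rewrite !(mul0mx, addr0, add0r) !add_col_mx !vdotE -!scalar_mxM !mul_mx_scalar.
by rewrite !raddfD addr0 (add0r (r *: w)).
Qed.

(** As the adjoint is again a double star matrix, every statement about columns
    has a counterpart about rows, with [x] exchanged with [y] and [z] with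
    [w]. *)
Lemma adj_double_star m n (x y : 'cV[F]_m) (z w : 'cV[F]_n) a b :
  adj (double_star_mx x y z w a b) =
  double_star_mx (map_mx conj y) (map_mx conj x) (map_mx conj w)
    (map_mx conj z) (conj b) (conj a).
Proof.
by rewrite /double_star_mx !adjmx_block !adjmx0 !adjmx_scalar !adj_tr.
Qed.

(** Since [x] and [z] have nonzero entries, the range contains [(0, y, 0, 0)]
    and [(0, 0, 0, w)]. The only column of the matrix that meets the support of
    the first one is its first column, and the inner product there is [y^* y];
    likewise for the second one, the column of the second centre, and
    [w^* w]. *)
Lemma double_star_mp_anisotropic m n (x y : 'cV[F]_m) (z w : 'cV[F]_n) a b :
  (0 < m)%N -> (0 < n)%N ->
  (forall i, x i 0 != 0) -> (forall i, y i 0 != 0) ->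
  (forall i, z i 0 != 0) -> (forall i, w i 0 != 0) ->
  mp_invertible conj (double_star_mx x y z w a b) ->
  hvdot conj y y != 0 /\ hvdot conj w w != 0.
Proof.
move=> m0 n0 x0 y0 z0 w0 [X mpX].
have [dx xdx] := vdot_eq1_ex m0 x0; have [dz zdz] := vdot_eq1_ex n0 z0.
have nz p (v : 'cV[F]_p) : (0 < p)%N -> (forall i, v i 0 != 0) -> v <> 0.
  by case: p v => // p v _ v0 ve; have := v0 0; rewrite ve mxE eqxx.
split; apply/eqP=> h0.
- (* [dz] cancels the entry [b] of the first column. *)
  have Md : double_star_mx x y z w a b *m star_col 1 0 0 (- b *: dz) =
      star_col 0 y 0 0.
    rewrite double_star_col vdot0r vdotZr zdz !mulr1 mulr0 addr0 subrr.
    by rewrite scale1r scale0r.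
  have := mp_range_anisotropic (d := star_col 1 0 0 (- b *: dz)) mpX.
  rewrite Md adj_double_star double_star_col -(hvdotE y) h0 vdot0r !mulr0 addr0.
  rewrite !scale0r -star_col0 => /(_ erefl) /star_col_inj[_ y_eq0 _ _].
  exact: nz y_eq0.
- (* [dx] cancels the entry [a] of the column of the second centre. *)
  have Md : double_star_mx x y z w a b *m star_col 0 (- a *: dx) 1 0 =
      star_col 0 0 0 w.
    rewrite double_star_col vdot0r vdotZr xdx !mulr1 mulr0 addr0 addNr.
    by rewrite scale1r scale0r.
  have := mp_range_anisotropic (d := star_col 0 (- a *: dx) 1 0) mpX.
  rewrite Md adj_double_star double_star_col -(hvdotE w) h0 vdot0r !mulr0 addr0.
  rewrite !scale0r -star_col0 => /(_ erefl) /star_col_inj[_ _ _ w_eq0].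
  exact: nz w_eq0.
Qed.

(** * The Moore-Penrose inverse of a double star matrix *)

(** The inverse of the double star matrix with one leaf of unit weights on each
    side, that is, of the weighted adjacency matrix of a path on four
    vertices. *)
Definition unit_star_inv (a b : F) : 'M[F]_((1 + 1) + (1 + 1)) :=
  block_mx (block_mx 0 1%:M 1%:M 0) (block_mx 0 0 0 (- a)%:M)
           (block_mx 0 0 0 (- b)%:M) (block_mx 0 1%:M 1%:M 0).

(** The product of the Moore-Penrose inverses of the three factors in
    [double_star_factor], in reverse order. *)
Definition double_star_mp m n (x y : 'cV[F]_m) (z w : 'cV[F]_n) (a b : F) :
    'M[F]_((1 + m) + (1 + n)) :=
  star_diag ((hvdot conj x x)^-1 *: adj x^T) ((hvdot conj z z)^-1 *: adj z^T)
  *m unit_star_inv a b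
  *m star_diag ((hvdot conj y y)^-1 *: adj y) ((hvdot conj w w)^-1 *: adj w).

(** The leaves of each star act only through the functionals [x^T], [z^T] and
    the vectors [y], [w], so each set of leaves collapses to one vertex, which
    leaves a path on four vertices. *)
Lemma double_star_factor m n (x y : 'cV[F]_m) (z w : 'cV[F]_n) a b :
  double_star_mx x y z w a b =
  star_diag y w *m double_star_mx (1%:M : 'M_1) 1%:M (1%:M : 'M_1) 1%:M a b
    *m star_diag x^T z^T.
Proof.
rewrite /double_star_mx /star_diag !mulmx_block !trmx1.
rewrite !(mul0mx, mulmx0, addr0, add0r) !mulmx_block.
by rewrite !(mul0mx, mulmx0, addr0, add0r, mul1mx, mulmx1).
Qed.

Lemma unit_star_invP a b :
  double_star_mx (1%:M : 'M_1) 1%:M (1%:M : 'M_1) 1%:M a b *m unit_star_inv a b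
  = 1%:M.
Proof.
rewrite /double_star_mx /unit_star_inv !mulmx_block !trmx1.
rewrite !(mul0mx, mulmx0, addr0, add0r, mul1mx, mulmx1).
rewrite !add_block_mx !(addr0, add0r) -!raddfD !subrr raddf0 ?addNr ?raddf0.
by rewrite !block_mx0 -!scalar_mx_block.
Qed.

Lemma double_star_mp_inverse m n (x y : 'cV[F]_m) (z w : 'cV[F]_n) a b :
  hvdot conj x x != 0 -> hvdot conj y y != 0 ->
  hvdot conj z z != 0 -> hvdot conj w w != 0 ->
  is_mp_inverse conj (double_star_mx x y z w a b) (double_star_mp x y z w a b).
Proof.
move=> s0 u0 t0 v0; rewrite double_star_factor.
have left_inv p (c : 'cV[F]_p) : hvdot conj c c != 0 ->
    (hvdot conj c c)^-1 *: adj c *m c = 1%:M.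
  move=> c0; rewrite -scalemxAl [adj c *m c]vdotE -hvdotE.
  by rewrite scale_scalar_mx mulVf.
have right_inv p (c : 'cV[F]_p) : hvdot conj c c != 0 ->
    c^T *m ((hvdot conj c c)^-1 *: adj c^T) = 1%:M.
  move=> c0; rewrite -scalemxAr adj_tr vdotE vdotC -hvdotE.
  by rewrite scale_scalar_mx mulVf.
apply: mp_inverse_factor; rewrite ?unit_star_invP //.
- by rewrite star_diagM !left_inv // star_diag1.
- rewrite star_diagM adj_star_diag -!scalemxAr.
  by rewrite !adjmxZ !adjmxM !adjmxK // !fmorphV !hvdot_conj.
- by rewrite star_diagM !right_inv // star_diag1.
- rewrite star_diagM adj_star_diag -!scalemxAl.
  by rewrite !adjmxZ !adjmxM !adjmxK // !fmorphV !hvdot_conj.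
Qed.

Lemma double_star_mp_col m n (x y q : 'cV[F]_m) (z w s : 'cV[F]_n) a b p r :
  let q' := (hvdot conj y y)^-1 * hvdot conj y q in
  let s' := (hvdot conj w w)^-1 * hvdot conj w s in
  double_star_mp x y z w a b *m star_col p q r s =
  star_col q' (((hvdot conj x x)^-1 * (p - a * s')) *: map_mx conj x)
           s' (((hvdot conj z z)^-1 * (r - b * q')) *: map_mx conj z).
Proof.
move=> q' s'; rewrite /double_star_mp -!mulmxA star_diag_col.
rewrite -!scalemxAl [adj y *m q]vdotE [adj w *m s]vdotE -!hvdotE.
rewrite !scale_scalar_mx -/q' -/s'.
have -> : unit_star_inv a b *m star_col p q'%:M r s'%:M =
    star_col q' (p - a * s')%:M s' (r - b * q')%:M.
  rewrite /unit_star_inv /star_col !mul_block_col.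
  rewrite !(mul0mx, mul1mx, addr0, add0r) !add_col_mx -!scalar_mxM.
  by rewrite !(addr0, add0r) -!raddfD !mulNr [- _ + r]addrC.
by rewrite star_diag_col !mul_mx_scalar !scalerA !adj_tr ![_^-1 * _]mulrC.
Qed.

(** * The core EP inverse of a double star matrix *)

Lemma double_star_cycle2 m n (x y : 'cV[F]_m) (z w : 'cV[F]_n) a b :
  double_star_mx x y z w a b *m star_col 0 y b 0 =
  star_col (vdot x y + a * b) 0 0 (b *: w).
Proof. by rewrite double_star_col mulr0 vdot0r addr0 scale0r. Qed.

Lemma double_star_cycle1 m n (x y : 'cV[F]_m) (z w : 'cV[F]_n) a b :
  vdot z w = 0 ->
  double_star_mx x y z w a b *m star_col (vdot x y + a * b) 0 0 (b *: w) =
  (vdot x y + a * b) *: star_col 0 y b 0.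
Proof.
move=> zw; rewrite double_star_col star_colZ vdotZr zw !mulr0 vdot0r !addr0.
by rewrite scale0r scaler0 [b * _]mulrC.
Qed.

(** A passage through a leaf of the second star contributes the factor
    [z^T w = 0]. After three steps only the plane of the two vectors exchanged
    in [double_star_cycle1] and [double_star_cycle2] is left as the range. *)
Lemma double_star_exp3 m n (x y : 'cV[F]_m) (z w : 'cV[F]_n) a b :
  vdot z w = 0 ->
  double_star_mx x y z w a b ^+ 3 =
  star_col (vdot x y + a * b) 0 0 (b *: w)
    *m adj (star_col 0 (map_mx conj x) (conj a) 0) +
  star_col 0 y b 0
    *m adj (star_col (conj (vdot x y + a * b)) 0 0 (conj a *: map_mx conj z)).
Proof.
move=> zw; apply/matrixP=> i j.
have colE (A : 'M[F]_((1 + m) + (1 + n))) :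
    A i j = (A *m delta_mx j 0 : 'cV_(_)) i 0.
  by rewrite -colE mxE.
(* Both sides are compared as operators on columns. *)
rewrite colE [RHS]colE; have [p [q [r [s ->]]]] := star_colP (delta_mx j 0).
congr (fun_of_matrix _ i 0).
rewrite !exprS expr0 mulr1 -mulmxE -!mulmxA !double_star_col mulmxDl -!mulmxA.
rewrite !star_col_adjM !mul_mx_scalar !star_colZ star_colD.
rewrite !hvdotE -!map_mxZ !vdotZr !map_conjK !conjK.
rewrite !(map_mx0, rmorph0, vdot0l, vdotZl, scaler0, zw).
by congr star_col; rewrite ?addr0 ?add0r ?scalerA; try congr (_ *: _); ring.
Qed.

Lemma double_star_adj_cycle1 m n (x y : 'cV[F]_m) (z w : 'cV[F]_n) a b :
  let zeta := vdot x y + a * b in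
  adj (double_star_mx x y z w a b) *m star_col zeta 0 0 (b *: w) =
  star_col 0 (zeta *: map_mx conj x)
    (conj a * zeta + b * hvdot conj w w) 0.
Proof.
move=> zeta; rewrite adj_double_star double_star_col vdot0r mulr0 addr0.
by rewrite scale0r vdotZr.
Qed.

Lemma double_star_adj_cycle2 m n (x y : 'cV[F]_m) (z w : 'cV[F]_n) a b :
  adj (double_star_mx x y z w a b) *m star_col 0 y b 0 =
  star_col (b * conj b + hvdot conj y y) 0 0 (b *: map_mx conj z).
Proof.
rewrite adj_double_star double_star_col vdot0r mulr0 addr0 scale0r.
by rewrite addrC mulrC.
Qed.

(** The vectors [g2 = (0, y, b, 0)] and [g1 = (zeta, 0, 0, b w)] are
    eigenvectors of the square for the eigenvalue [zeta]. The adjoint sends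
    [g2] to [(h, 0, 0, b (conj z))], and applied twice it sends [g1] to
    [(beta, 0, 0, c (conj z))] for some scalar [c]. Once [h] or [beta]
    vanishes, one more application of the adjoint gives zero because
    [z^T w = 0]. *)
Lemma double_star_core_anisotropic m n (x y : 'cV[F]_m) (z w : 'cV[F]_n) a b :
  let zeta := vdot x y + a * b in
  zeta != 0 -> b != 0 -> vdot z w = 0 ->
  core_ep_invertible conj (double_star_mx x y z w a b) ->
  b * conj b + hvdot conj y y != 0 /\
  zeta * conj zeta + b * conj b * hvdot conj w w != 0.
Proof.
move=> zeta zeta0 b0 zw [X cX].
have zwc : vdot (map_mx conj w) (map_mx conj z) = 0.
  by rewrite vdot_conj vdotC zw rmorph0.
set M := double_star_mx _ _ _ _ _ _ in cX.
have Mg1 : M *m star_col zeta 0 0 (b *: w) = zeta *: star_col 0 y b 0.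
  exact: double_star_cycle1.
have Mg2 : M *m star_col 0 y b 0 = star_col zeta 0 0 (b *: w).
  exact: double_star_cycle2.
split; apply/eqP=> h0.
- have : star_col 0 y b (0 : 'cV_n) = 0.
    apply: (core_ep_eigen_anisotropic (j := 1) (k := 1) cX zeta0).
      by rewrite expr2 -mulmxE -mulmxA Mg2 Mg1.
    rewrite expr2 -mulmxE -mulmxA double_star_adj_cycle2 h0.
    rewrite adj_double_star double_star_col vdot0r vdotZr zwc !mulr0 !addr0.
    by rewrite !scale0r star_col0.
  by rewrite -star_col0 => /star_col_inj[_ _ /eqP]; rewrite (negPf b0).
- have : star_col zeta (0 : 'cV_m) 0 (b *: w) = 0.
    apply: (core_ep_eigen_anisotropic (j := 1) (k := 2) cX zeta0).
      by rewrite expr2 -mulmxE -mulmxA Mg1 -scalemxAr Mg2.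
    rewrite 2!exprS expr1 -mulmxE -!mulmxA double_star_adj_cycle1.
    rewrite adj_double_star !double_star_col !vdotZr !vdot0r zwc vdot_conj.
    rewrite (vdotC y) -/zeta.
    have -> : zeta * conj (vdot x y) +
        conj b * (conj a * zeta + b * hvdot conj w w) = 0.
      by rewrite -[RHS]h0 rmorphD rmorphM; ring.
    by rewrite !(mulr0, mul0r, addr0, scale0r) star_col0.
  by rewrite -star_col0 => /star_col_inj[/eqP]; rewrite (negPf zeta0).
Qed.

Lemma double_star_core_ep m n (x y : 'cV[F]_m) (z w : 'cV[F]_n) a b :
  let zeta := vdot x y + a * b in
  let h := b * conj b + hvdot conj y y in
  let beta := zeta * conj zeta + b * conj b * hvdot conj w w in
  let g1 := star_col zeta 0 0 (b *: w) in
  let g2 := star_col 0 y b 0 in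
  zeta != 0 -> h != 0 -> beta != 0 -> vdot z w = 0 ->
  is_core_ep_inverse conj (double_star_mx x y z w a b)
    (beta^-1 *: (g2 *m adj g1) + (zeta * h)^-1 *: (g1 *m adj g2)).
Proof.
move=> zeta h beta g1 g2 zeta0 h0 beta0 zw.
apply: (core_ep_two_cycle zeta0 beta0 h0).
- rewrite star_col_adjM !hvdotE map_mxZ vdotZl vdotZr !vdot0r -hvdotE.
  by congr (_%:M); rewrite /beta; ring.
- rewrite star_col_adjM !hvdotE !vdot0r -hvdotE.
  by congr (_%:M); rewrite /h; ring.
- rewrite star_col_adjM !hvdotE !vdot0r map_mx0 !vdot0l rmorph0.
  by rewrite !(mulr0, mul0r, addr0) raddf0.
- exact: double_star_cycle2.
- exact: double_star_cycle1.
- exact: double_star_exp3.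
Qed.

(** * The generalized dual core inverse of a double star matrix *)

Lemma star_col_outer m n m' n' p (q : 'cV[F]_m) r (s : 'cV[F]_n)
    p' (q' : 'cV[F]_m') r' (s' : 'cV[F]_n') :
  star_col p q r s *m adj (star_col p' q' r' s') =
  block_mx
    (block_mx (p * conj p')%:M (p *: adj q') (conj p' *: q) (q *m adj q'))
    (block_mx (p * conj r')%:M (p *: adj s') (conj r' *: q) (q *m adj s'))
    (block_mx (r * conj p')%:M (r *: adj q') (conj p' *: s) (s *m adj q'))
    (block_mx (r * conj r')%:M (r *: adj s') (conj r' *: s) (s *m adj s')).
Proof.
rewrite /star_col !adjmx_col !mul_col_row !adjmx_scalar -!scalar_mxM.
by rewrite !mul_mx_scalar !mul_scalar_mx.
Qed.

(** The core EP inverse is a combination of [g2 g1^*] and [g1 g2^*], so only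
    four vectors are needed: the images of [g1], [g2] under the Moore-Penrose
    inverse on the left, and under the adjoint of the matrix on the right. *)
Lemma double_star_gdc m n (x y : 'cV[F]_m) (z w : 'cV[F]_n) a b :
  let zeta := vdot x y + a * b in
  let s := hvdot conj x x in
  let h := b * conj b + hvdot conj y y in
  let beta := zeta * conj zeta + b * conj b * hvdot conj w w in
  let g1 := star_col zeta 0 0 (b *: w) in
  let g2 := star_col 0 y b 0 in
  s != 0 -> hvdot conj y y != 0 -> hvdot conj w w != 0 ->
  h != 0 -> zeta != 0 ->
  double_star_mp x y z w a b
    *m (beta^-1 *: (g2 *m adj g1) + (zeta * h)^-1 *: (g1 *m adj g2))
    *m double_star_mx x y z w a b =
    block_mx
      (block_mx 0 ((beta^-1 * conj zeta) *: x^T)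
                (((s * zeta)^-1 * vdot x y) *: map_mx conj x) 0)
      (block_mx (beta^-1 * (a * conj zeta + conj b * hvdot conj w w))%:M 0
                0 ((conj b * (h * s * zeta)^-1 * vdot x y) *:
                   (map_mx conj x *m z^T)))
      (block_mx (b * zeta^-1)%:M 0
                0 0)
      (block_mx 0 ((b * conj b * (h * zeta)^-1) *: z^T)
                0 0).
Proof.
move=> zeta s h beta g1 g2 s0 u0 v0 h0 zeta0.
set D := double_star_mp _ _ _ _ _ _; set M := double_star_mx _ _ _ _ _ _.
have Dg2 : D *m g2 = star_col 1 0 0 0.
  rewrite /D double_star_mp_col [hvdot conj w 0]vdot0r mulVf // !mulr0 mulr1.
  by rewrite !subrr !mulr0 !scale0r.
have Dg1 : D *m g1 = star_col 0 ((s^-1 * vdot x y) *: map_mx conj x) b 0.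
  rewrite /D double_star_mp_col [hvdot conj y 0]vdot0r !hvdotE vdotZr -!hvdotE.
  rewrite !mulr0 subrr mulr0 scale0r.
  by rewrite [_^-1 * (b * _)]mulrCA !mulVf // !mulr1 /zeta addrK.
clearbody D.
rewrite mulmxDr mulmxDl -!scalemxAr -!scalemxAl -!mulmxA.
have adjM g : adj g *m M = adj (adj M *m g) by rewrite adjmxM adjmxK.
rewrite !adjM double_star_adj_cycle1 double_star_adj_cycle2 -/zeta -/h.
rewrite !(mulmxA D) Dg1 Dg2.
rewrite !star_col_outer !scale_block_mx !add_block_mx.
rewrite !adjmxZ !adjmx0 !mulmx0 !mul0mx !scaler0 !scale0r.
have hh : conj h = h.
  by rewrite rmorphD rmorphM hvdot_conj // conjK mulrC.
clearbody zeta.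
have adj_conj p (c : 'cV[F]_p) : adj (map_mx conj c) = c^T.
  by rewrite -adj_tr adjmxK.
rewrite !adj_conj hh rmorph0 !(mulr0, mul0r, raddf0, scaler0, scale0r, scale1r).
rewrite !(addr0, add0r) mul1r (rmorphD conj) !(rmorphM conj) conjK.
rewrite hvdot_conj //.
rewrite -!(scalemxAl, scalemxAr) !scale_scalar_mx !scalerA.
congr (block_mx (block_mx _ _ _ _) (block_mx _ _ _ _) (block_mx _ _ _ _)
  (block_mx _ _ _ _)); (try congr (_ *: _)); try congr (_%:M).
all: by field; rewrite ?s0 ?h0 ?zeta0.
Qed.

End DoubleStar.

Theorem lemma6p2 (F : fieldType) (conj : {rmorphism F -> F})
    (conjK : involutive conj) (m n : nat) (m_gt0 : (0 < m)%N)
    (n_gt0 : (0 < n)%N) (x y : 'cV[F]_m) (z w : 'cV[F]_n) (a b : F)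
    (x_neq0 : forall i, x i 0 != 0) (y_neq0 : forall i, y i 0 != 0)
    (z_neq0 : forall i, z i 0 != 0) (w_neq0 : forall i, w i 0 != 0)
    (a_neq0 : a != 0) (b_neq0 : b != 0)
    (xy_neq0 : vdot x y != 0) (zw_eq0 : vdot z w = 0)
    (zeta_neq0 : vdot x y + a * b != 0) :
  let M := double_star_mx x y z w a b in
  let zeta := vdot x y + a * b in
  let s := hvdot conj x x in
  let u := hvdot conj y y in
  let t := hvdot conj z z in
  let v := hvdot conj w w in
  let h := b * conj b + hvdot conj y y in
  let beta := zeta * conj zeta + b * conj b * hvdot conj w w in
  let G : 'M[F]_((1 + m) + (1 + n)) :=
    block_mx
      (block_mx 0 ((beta^-1 * conj zeta) *: x^T)
                (((s * zeta)^-1 * vdot x y) *: map_mx conj x) 0)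
      (block_mx (beta^-1 * (a * conj zeta + conj b * hvdot conj w w))%:M 0
                0 ((conj b * (h * s * zeta)^-1 * vdot x y) *:
                   (map_mx conj x *m z^T)))
      (block_mx (b * zeta^-1)%:M 0
                0 0)
      (block_mx 0 ((b * conj b * (h * zeta)^-1) *: z^T)
                0 0) in
  (mp_invertible conj M /\ core_ep_invertible conj M <->
     [&& s != 0, u != 0, t != 0, v != 0, h != 0 & beta != 0]) /\
  (mp_invertible conj M -> core_ep_invertible conj M ->
     unique (is_gdc_inverse conj M) G).
Proof.
move=> M zeta s u t v h beta G.
have equiv : mp_invertible conj M /\ core_ep_invertible conj M <->
    [&& s != 0, u != 0, t != 0, v != 0, h != 0 & beta != 0].
  split=> [[mpM cepM] | /and5P[s0 u0 t0 v0 /andP[h0 beta0]]].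
    have [u0 v0] := double_star_mp_anisotropic m_gt0 n_gt0 x_neq0 y_neq0
      z_neq0 w_neq0 mpM.
    have [h0 beta0] := double_star_core_anisotropic zeta_neq0 b_neq0
      zw_eq0 cepM.
    have conj_neq0 p (c : 'cV[F]_p) : (forall i, c i 0 != 0) ->
        forall i, map_mx conj c i 0 != 0.
      by move=> c0 i; rewrite mxE fmorph_eq0.
    have mpMadj : mp_invertible conj (adjmx conj M).
      by have [X mpX] := mpM; exists (adjmx conj X); apply: mp_inverse_adj.
    rewrite adj_double_star in mpMadj.
    have [s0 t0] := double_star_mp_anisotropic m_gt0 n_gt0
      (conj_neq0 _ _ y_neq0) (conj_neq0 _ _ x_neq0)
      (conj_neq0 _ _ w_neq0) (conj_neq0 _ _ z_neq0) mpMadj.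
    have norm_conj p (c : 'cV[F]_p) :
        hvdot conj (map_mx conj c) (map_mx conj c) = hvdot conj c c.
      by rewrite !hvdotE map_conjK // vdotC.
    rewrite !norm_conj in s0 t0.
    by apply/and5P; split=> //; apply/andP.
  split; first by exists (double_star_mp conj x y z w a b);
    apply: double_star_mp_inverse.
  by eexists; apply: double_star_core_ep.
split=> // mpM cepM.
have /and5P[s0 u0 t0 v0 /andP[h0 beta0]] := equiv.1 (Logic.conj mpM cepM).
rewrite /G -(double_star_gdc conjK) //.
apply: gdc_inverse_unique; first exact: double_star_mp_inverse.
exact: double_star_core_ep.
Qed.
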